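(* Let $R$ be a commutative integral domain with unit, let $a \in R$ and $n \ge 1$, and let $f(t) = (t-a)^n \in R[t]$. Then there exists an isomorphism of groups between $\operatorname{Aut}(I_f)$ and $R^\times$.
   Context: For $f \in R[t]$, $I_f$ denotes the ideal of $R[t]$ generated by $f$, viewed as an associative commutative $R$-algebra without unit. $\operatorname{Aut}(I_f)$ is the group (under composition) of $R$-algebra automorphisms of $I_f$, i.e. bijective $R$-linear multiplicative maps $I_f \to I_f$. $R^\times$ is the multiplicative group of invertible elements of $R$. *)

(* Defs.v *)
From HB Require Import structures.
From mathcomp Require Import all_boot all_order all_algebra.
From mathcomp Require Import boolp.

Set Implicit Arguments.
Unset Strict Implicit.
Unset Printing Implicit Defensive.

Import GRing.Theory.
Local Open Scope ring_scope.

(* Associative commutative algebras over R, not required to have a unit. *)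
HB.mixin Record Lmodule_isNuComAlgebra (R : comNzRingType) A
    of GRing.Lmodule R A := {
  numul : A -> A -> A;
  numulA : associative numul;
  numulC : commutative numul;
  numulDl : left_distributive numul +%R;
  scale_numulAl : forall (k : R) (x y : A),
    k *: numul x y = numul (k *: x) y
}.

#[short(type="nuComAlgType")]
HB.structure Definition NuComAlgebra (R : comNzRingType) :=
  {A of Lmodule_isNuComAlgebra R A & GRing.Lmodule R A}.

Section AutomorphismGroup.
Variables (R : comNzRingType) (A : nuComAlgType R).

Definition is_nuaut (phi : A -> A) : Prop :=
  [/\ linear phi, {morph phi : x y / numul x y} & bijective phi].

(* is_nuaut is reflected in bool by `[< _ >] so that nuaut is a subType of
   A -> A, equality of automorphisms being equality of functions. *)
Record nuaut := NuAut { nuaut_fun :> A -> A; _ : `[< is_nuaut nuaut_fun >] }.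

HB.instance Definition _ := [isSub for nuaut_fun].
HB.instance Definition _ := [Choice of nuaut by <:].

Implicit Types phi psi : nuaut.

Lemma nuautP phi : is_nuaut phi.
Proof. by case: phi => phi /= /asboolP. Qed.

Lemma nuaut_eqP phi psi : phi =1 psi -> phi = psi.
Proof. by move=> e; apply/val_inj/funext. Qed.

Fact nuaut_one_subproof : `[< is_nuaut id >].
Proof. by apply/asboolP; split=> //; exists id. Qed.
Definition nuaut_one := NuAut nuaut_one_subproof.

Fact nuaut_mul_subproof phi psi : `[< is_nuaut (phi \o psi) >].
Proof.
have [phiL phiM phiB] := nuautP phi; have [psiL psiM psiB] := nuautP psi.
apply/asboolP; split; last exact: bij_comp.
- by move=> k x y /=; rewrite psiL phiL.
- by move=> x y /=; rewrite psiM phiM.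
Qed.
Definition nuaut_mul phi psi := NuAut (nuaut_mul_subproof phi psi).

Fact nuaut_inv_ex phi : exists psi : A -> A, cancel phi psi /\ cancel psi phi.
Proof. by have [_ _ [psi phiK psiK]] := nuautP phi; exists psi. Qed.
Definition nuaut_invfun phi : A -> A := sval (cid (nuaut_inv_ex phi)).

Lemma nuaut_invfunK phi : cancel phi (nuaut_invfun phi).
Proof. by rewrite /nuaut_invfun; case: cid => psi []. Qed.

Lemma nuaut_invfunKV phi : cancel (nuaut_invfun phi) phi.
Proof. by rewrite /nuaut_invfun; case: cid => psi []. Qed.

Fact nuaut_inv_subproof phi : `[< is_nuaut (nuaut_invfun phi) >].
Proof.
have [phiL phiM _] := nuautP phi.
have phiK := nuaut_invfunK phi; have phiKV := nuaut_invfunKV phi.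
apply/asboolP; split; last by exists phi.
- by move=> k x y; apply: (can_inj phiK); rewrite phiL !phiKV.
- by move=> x y; apply: (can_inj phiK); rewrite phiM !phiKV.
Qed.
Definition nuaut_inv phi := NuAut (nuaut_inv_subproof phi).

Fact nuaut_mulA : associative nuaut_mul.
Proof. by move=> phi psi chi; apply: nuaut_eqP. Qed.
Fact nuaut_mul1 : left_id nuaut_one nuaut_mul.
Proof. by move=> phi; apply: nuaut_eqP. Qed.
Fact nuaut_mulr1 : right_id nuaut_one nuaut_mul.
Proof. by move=> phi; apply: nuaut_eqP. Qed.
Fact nuaut_mulV : left_inverse nuaut_one nuaut_inv nuaut_mul.
Proof. by move=> phi; apply: nuaut_eqP => x; apply: nuaut_invfunK. Qed.
Fact nuaut_mulrV : right_inverse nuaut_one nuaut_inv nuaut_mul.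
Proof. by move=> phi; apply: nuaut_eqP => x; apply: nuaut_invfunKV. Qed.

HB.instance Definition _ := isGroup.Build nuaut
  nuaut_mulA nuaut_mul1 nuaut_mulr1 nuaut_mulV nuaut_mulrV.

End AutomorphismGroup.

Section PrincipalIdeal.
Variables (R : comNzRingType) (f : {poly R}).

Definition pideal : {pred {poly R}} := fun p => `[< exists q, p = q * f >].

Lemma pidealP p : reflect (exists q, p = q * f) (p \in pideal).
Proof. exact: asboolP. Qed.

Fact pideal_submod : submod_closed pideal.
Proof.
split=> [|k _ _ /pidealP[p ->] /pidealP[q ->]].
  by apply/pidealP; exists 0; rewrite mul0r.
by apply/pidealP; exists (k *: p + q); rewrite mulrDl scalerAl.
Qed.
HB.instance Definition _ :=
  GRing.isSubmodClosed.Build R {poly R} pideal pideal_submod.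

Record ideal := Ideal { ideal_val :> {poly R}; _ : ideal_val \in pideal }.

HB.instance Definition _ := [isSub for ideal_val].
HB.instance Definition _ := [Choice of ideal by <:].
HB.instance Definition _ := [SubChoice_isSubLmodule of ideal by <:].

Implicit Types p q : ideal.

Fact ideal_mul_subproof p q : (p : {poly R}) * (q : {poly R}) \in pideal.
Proof.
case: q => _ /= /pidealP[q ->]; apply/pidealP.
by exists ((p : {poly R}) * q); rewrite mulrA.
Qed.
Definition ideal_mul p q := Ideal (ideal_mul_subproof p q).

Fact ideal_mulA : associative ideal_mul.
Proof. by move=> p q r; apply/val_inj/mulrA. Qed.
Fact ideal_mulC : commutative ideal_mul.
Proof. by move=> p q; apply/val_inj/mulrC. Qed.
Fact ideal_mulDl : left_distributive ideal_mul +%R.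
Proof. by move=> p q r; apply/val_inj/mulrDl. Qed.
Fact ideal_scaleAl (k : R) p q : k *: ideal_mul p q = ideal_mul (k *: p) q.
Proof. by apply/val_inj/scalerAl. Qed.

HB.instance Definition _ := Lmodule_isNuComAlgebra.Build R ideal
  ideal_mulA ideal_mulC ideal_mulDl ideal_scaleAl.

End PrincipalIdeal.

(* finalg's {unit R} is only available for finite R. *)
Section UnitGroup.
Variable R : unitRingType.

Record units := Units { units_val :> R; _ : units_val \is a GRing.unit }.

HB.instance Definition _ := [isSub for units_val].
HB.instance Definition _ := [Choice of units by <:].

Implicit Types u v : units.

Lemma unitsP u : (u : R) \is a GRing.unit.
Proof. by case: u. Qed.

Fact units_one_subproof : (1 : R) \is a GRing.unit.
Proof. exact: unitr1. Qed.
Definition units_one := Units units_one_subproof.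

Fact units_mul_subproof u v : (u : R) * (v : R) \is a GRing.unit.
Proof. by rewrite unitrMr unitsP. Qed.
Definition units_mul u v := Units (units_mul_subproof u v).

Fact units_inv_subproof u : (u : R)^-1 \is a GRing.unit.
Proof. by rewrite unitrV unitsP. Qed.
Definition units_inv u := Units (units_inv_subproof u).

Fact units_mulA : associative units_mul.
Proof. by move=> u v w; apply/val_inj/mulrA. Qed.
Fact units_mul1 : left_id units_one units_mul.
Proof. by move=> u; apply/val_inj/mul1r. Qed.
Fact units_mulr1 : right_id units_one units_mul.
Proof. by move=> u; apply/val_inj/mulr1. Qed.
Fact units_mulV : left_inverse units_one units_inv units_mul.
Proof. by move=> u; apply/val_inj/mulVr/unitsP. Qed.
Fact units_mulrV : right_inverse units_one units_inv units_mul.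
Proof. by move=> u; apply/val_inj/mulrV/unitsP. Qed.

HB.instance Definition _ := isGroup.Build units
  units_mulA units_mul1 units_mulr1 units_mulV units_mulrV.

End UnitGroup.

(* Main.v *)
(* Put T = t - a, and let phi be an automorphism of I = (T^n).  Multiplicativity
   forces deg phi(T^k) = m k for a fixed m >= 1 and all k >= n, hence
   deg phi(p) = m deg p on I, and m = 1 because T^n is in the image.  So
   phi(T^n) has degree n and is divisible by T^n: phi(T^n) = b T^n, where b is
   a unit (apply the same to the inverse of phi).  Next phi(T^(n+1)) = l T^n for
   some l of degree one, and with s = l / b multiplicativity gives
   phi(T^k) = s^(k-n) phi(T^n); from phi(T^(2n)) = phi(T^n)^2 one gets
   s^n = b T^n, so s vanishes at a, s = c T with c^n = b a unit, and
   phi(p(T)) = p(c T). *)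
Require Import Defs.
From HB Require Import structures.
From mathcomp Require Import all_boot all_order all_algebra.
From mathcomp Require Import boolp zify ring.

Import GRing.Theory.
Local Open Scope ring_scope.

(** * Dilations of the line centred at [a] *)

Section Dilation.
Set Implicit Arguments.
Unset Strict Implicit.
Unset Printing Implicit Defensive.
Variables (R : idomainType) (a : R).
Local Notation T := ('X - a%:P).

(** The substitution t -> a + c (t - a): in the coordinate [T] it is p(T) -> p(c T). *)
Definition dilation (c : R) (p : {poly R}) : {poly R} :=
  p \Po (c *: T + a%:P).

Lemma dilationXsubC c : dilation c T = c *: T.
Proof. by rewrite /dilation comp_polyB comp_polyX comp_polyC addrK. Qed.

Lemma dilation_linear c : linear (dilation c).
Proof. by move=> k p q; rewrite /dilation comp_polyD comp_polyZ. Qed.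

Lemma dilationM c p q : dilation c (p * q) = dilation c p * dilation c q.
Proof. exact: comp_polyM. Qed.

Lemma dilationXn c k : dilation c (T ^+ k) = c ^+ k *: T ^+ k.
Proof.
elim: k => [|k IHk]; first by rewrite !expr0 scale1r /dilation comp_polyC.
by rewrite !exprS dilationM IHk dilationXsubC -scalerAl -scalerAr scalerA.
Qed.

Lemma dilation_comp c d p : dilation c (dilation d p) = dilation (c * d) p.
Proof.
rewrite /dilation -comp_polyA comp_polyD comp_polyZ comp_polyC.
by have /= := dilationXsubC c; rewrite /dilation => ->;
  rewrite scalerA (mulrC d).
Qed.

Lemma dilation1 p : dilation 1 p = p.
Proof. by rewrite /dilation scale1r subrK comp_polyXr. Qed.

Lemma dilation_pideal c n p :
  p \in pideal (T ^+ n) -> dilation c p \in pideal (T ^+ n).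
Proof.
case/pidealP=> q ->; apply/pidealP; exists (c ^+ n *: dilation c q).
by rewrite dilationM dilationXn -scalerAr -scalerAl.
Qed.

End Dilation.

(** * Powers of [T] in the ideal and leading-term reduction *)

Section Automorphisms.
Set Implicit Arguments.
Unset Strict Implicit.
Unset Printing Implicit Defensive.
Variables (R : idomainType) (a : R) (n : nat).
Local Notation T := ('X - a%:P).

(* Naming the generator makes all occurrences of [I] syntactically equal:
   inlined, the power would be elaborated along different coercion paths. *)
Definition XsubC_exp : {poly R} := T ^+ n.
Local Notation I := (ideal XsubC_exp).

Lemma ideal_val_inj : injective (fun p : I => p : {poly R}).
Proof. exact: val_inj. Qed.

Lemma ideal_valM (p q : I) : numul p q = (p : {poly R}) * q :> {poly R}.
Proof. by []. Qed.

Lemma ideal_valD (p q : I) : (p + q : I) = (p : {poly R}) + q :> {poly R}.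
Proof. exact: (raddfD (val : I -> {poly R})). Qed.

Lemma ideal_valZ (k : R) (p : I) :
  (k *: p : I) = k *: (p : {poly R}) :> {poly R}.
Proof. exact: GRing.valZ. Qed.

Lemma ideal_val_eq0 (p : I) : ((p : {poly R}) == 0) = (p == 0).
Proof. by []. Qed.

Lemma ideal_poly_subproof (q : {poly R}) : q * T ^+ n \in pideal XsubC_exp.
Proof. by apply/pidealP; exists q. Qed.
Definition ideal_poly q : I := Ideal (ideal_poly_subproof q).

Lemma idealE (p : I) : exists q : {poly R}, p = q * T ^+ n :> {poly R}.
Proof. by case: p => p /= /pidealP. Qed.

(** The index counts the exponent beyond [n]: these monic elements, one in each degree from [n] on,
    span the ideal over [R]. *)
Definition ideal_pow k : I := ideal_poly (T ^+ k).

Lemma ideal_powE k : ideal_pow k = T ^+ (k + n) :> {poly R}.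
Proof. by rewrite exprD. Qed.

Lemma ideal_pow_mul i j i' j' : (i + j = i' + j')%N ->
  numul (ideal_pow i) (ideal_pow j) = numul (ideal_pow i') (ideal_pow j').
Proof.
move=> eq_ij; apply: ideal_val_inj.
rewrite !ideal_valM !ideal_powE -!exprD; congr (_ ^+ _); lia.
Qed.

Lemma ideal_pow_sqr :
  numul (ideal_pow 0) (ideal_pow 0) = ideal_pow n.
Proof. by apply: ideal_val_inj; rewrite ideal_valM !ideal_powE -!exprD. Qed.

Lemma ideal_pow_neq0 k : ideal_pow k != 0.
Proof. by rewrite -ideal_val_eq0 ideal_powE expf_neq0 // polyXsubC_eq0. Qed.

Lemma size_ideal_gt (p : I) : p != 0 -> (n < size p)%N.
Proof.
rewrite -ideal_val_eq0; have [q ->] := idealE p => qT_neq0.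
have q_neq0 : q != 0 by apply: contra_neq qT_neq0 => ->; rewrite mul0r.
rewrite size_mul ?expf_neq0 ?polyXsubC_eq0 // size_exp_XsubC addnS /=.
by rewrite -[X in (X < _)%N]add0n ltn_add2r size_poly_gt0.
Qed.

(** Since [ideal_pow k] is monic, subtracting its multiple by the leading coefficient lowers the
    degree without leaving the ideal. This drives the inductions on size below. *)
Lemma ideal_lead_split (p : I) : p != 0 ->
  exists k (r : I),
    [/\ p = lead_coef p *: ideal_pow k + r, size p = (k + n).+1
      & (size r < size p)%N].
Proof.
move=> p_neq0; have size_p := size_ideal_gt p_neq0.
pose k := ((size p).-1 - n)%N.
have size_pE : size p = (k + n).+1 by lia.
exists k, (p - lead_coef p *: ideal_pow k); split=> //.
  by rewrite [RHS]addrC subrK.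
have -> : (p - lead_coef p *: ideal_pow k : I)
    = (p : {poly R}) - lead_coef p *: T ^+ (k + n) :> {poly R}.
  by rewrite -ideal_powE -scaleNr ideal_valD ideal_valZ scaleNr.
rewrite size_pE ltnS; apply/leq_sizeP => j; rewrite coefB coefZ leq_eqVlt.
case/predU1P=> [<-|lt_j]; last first.
  by rewrite !nth_default ?mulr0 ?subr0 ?size_exp_XsubC ?size_pE.
have := monicP (monic_exp (k + n) (monicXsubC a)).
rewrite lead_coefE size_exp_XsubC /= => ->.
by rewrite mulr1 lead_coefE size_pE subrr.
Qed.

(** * Automorphisms preserve degree *)

Section OneAutomorphism.
Variable phi : nuaut I.
Local Notation img p := (ideal_val (phi p)).

Lemma nuautL : linear phi. Proof. by have [] := nuautP phi. Qed.

Lemma nuautD p q : phi (p + q) = phi p + phi q.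
Proof. by have := nuautL 1 p q; rewrite !scale1r. Qed.

Lemma nuaut0 : phi 0 = 0.
Proof. by apply: (addrI (phi 0)); rewrite -nuautD !addr0. Qed.

Lemma nuautZ k p : phi (k *: p) = k *: phi p.
Proof. by have := nuautL k p 0; rewrite nuaut0 !addr0. Qed.

Lemma nuaut_numul p q : img (numul p q) = img p * img q.
Proof. by have [_ -> _] := nuautP phi. Qed.

Lemma nuaut_eq0 p : (phi p == 0) = (p == 0).
Proof. by rewrite -{1}nuaut0 (inj_eq (can_inj (nuaut_invfunK phi))). Qed.

Lemma size_nuaut_numul p q : p != 0 -> q != 0 ->
  (size (img (numul p q))).-1 = ((size (img p)).-1 + (size (img q)).-1)%N.
Proof.
rewrite -(nuaut_eq0 p) -(nuaut_eq0 q) -!ideal_val_eq0 => p0 q0.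
by rewrite nuaut_numul size_mul // (polySpred p0) (polySpred q0) addSn addnS.
Qed.

Lemma nuaut_pow_step k :
  img (ideal_pow k.+1) * img (ideal_pow 0)
    = img (ideal_pow k) * img (ideal_pow 1).
Proof. by rewrite -!nuaut_numul (@ideal_pow_mul k.+1 0 k 1) // addn0 addn1. Qed.

Lemma nuaut_pow_sqr :
  img (ideal_pow n) = img (ideal_pow 0) ^+ 2.
Proof. by rewrite -ideal_pow_sqr nuaut_numul expr2. Qed.

Lemma size_nuaut_gt0 p : p != 0 -> (n < size (img p))%N.
Proof. by rewrite -nuaut_eq0 => /size_ideal_gt. Qed.

Hypothesis n_gt0 : (0 < n)%N.

(** Degrees add in products, so the degrees [s k] of the images form an arithmetic progression.
    Squaring T^n gives [s n = 2 * s 0], which forces [s 0] to be [n] times the common difference. *)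
Lemma size_nuaut_pow : exists2 m, (0 < m)%N &
  forall k, size (img (ideal_pow k)) = (m * (k + n)).+1.
Proof.
pose s k := (size (img (ideal_pow k))).-1.
have sE k : size (img (ideal_pow k)) = (s k).+1.
  by have := size_nuaut_gt0 (ideal_pow_neq0 k); rewrite /s; lia.
have sS k : (s k.+1 + s 0 = s k + s 1)%N.
  rewrite -!size_nuaut_numul ?ideal_pow_neq0 //.
  by rewrite (@ideal_pow_mul k.+1 0 k 1) // addn0 addn1.
have s_sqr : (s n = s 0 + s 0)%N.
  by rewrite -size_nuaut_numul ?ideal_pow_neq0 // ideal_pow_sqr.
have s0 : (n <= s 0)%N.
  by have := size_nuaut_gt0 (ideal_pow_neq0 0); rewrite sE.
have s_lin k : (s k + k * s 0 = s 0 + k * s 1)%N.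
  elim: k => [|k IHk]; first by rewrite !mul0n.
  by have := sS k; rewrite !mulSn; lia.
have s_n := s_lin n.
have s_lt : (s 0 < s 1)%N.
  (* By [s_n] and [s_sqr], [s 0 + n * s 0 = n * s 1]; with [s 1 <= s 0] this gives [s 0 = 0],
     against [0 < n <= s 0]. *)
  by rewrite ltnNge; apply/negP => le_s; have := leq_mul (leqnn n) le_s; lia.
exists (s 1 - s 0)%N => [|k]; first lia.
rewrite sE; congr _.+1; have := s_lin k.
have -> : (s 1 = (s 1 - s 0) + s 0)%N by lia.
rewrite addnK; nia.
Qed.

(** Strong induction on size: as [m > 0], the image of the leading term has larger degree than the
    image of the remainder, so nothing cancels at the top. *)
Lemma size_nuaut : exists2 m, (0 < m)%N &
  forall p : I, p != 0 -> size (img p) = (m * (size p).-1).+1.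
Proof.
have [m m_gt0 size_pow] := size_nuaut_pow; exists m => // p.
have [d] := ubnP (size p); elim: d p => // d IHd p lt_pd p_neq0.
have [k [r [pE size_p lt_r]]] := ideal_lead_split p_neq0.
have lc_neq0 : lead_coef p != 0 by rewrite lead_coef_eq0.
have size_lead : size (img (lead_coef p *: ideal_pow k)) = (m * (k + n)).+1.
  by rewrite nuautZ ideal_valZ size_scale // size_pow.
rewrite {1}pE nuautD ideal_valD size_polyDl size_lead ?size_p //.
have [->|r_neq0] := eqVneq r 0; first by rewrite nuaut0 size_poly0.
rewrite IHd //; last by lia.
rewrite ltnS ltn_mul2l m_gt0 -ltnS -size_p.
by rewrite (ltn_predK (size_ideal_gt r_neq0)).
Qed.

Lemma size_nuautE (p : I) : size (img p) = size p.
Proof.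
have [->|p_neq0] := eqVneq p 0; first by rewrite nuaut0.
have [m m_gt0 size_phi] := size_nuaut; rewrite size_phi //.
(* The preimage of T^n has some degree d >= n with m d = n, hence m = 1. *)
pose q := nuaut_invfun phi (ideal_pow 0).
have phi_q : phi q = ideal_pow 0 by rewrite nuaut_invfunKV.
have q_neq0 : q != 0 by rewrite -nuaut_eq0 phi_q ideal_pow_neq0.
have := size_phi q q_neq0; rewrite phi_q ideal_powE size_exp_XsubC add0n.
case; move: (size_ideal_gt q_neq0); case: (size q) => // d.
rewrite ltnS /= => le_nd nE.
have -> : m = 1%N by nia.
by rewrite mul1n (ltn_predK (size_ideal_gt p_neq0)).
Qed.

Lemma nuaut_pow0 : exists b, img (ideal_pow 0) = b *: T ^+ n.
Proof.
have [q qE] := idealE (phi (ideal_pow 0)).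
have := size_nuautE (ideal_pow 0).
rewrite qE ideal_powE size_exp_XsubC add0n => size_q.
have q_neq0 : q != 0.
  by apply: contra_eq_neq size_q => ->; rewrite mul0r size_poly0.
have /eqP/size_poly1P[b _ ->] : size q = 1%N.
  move: size_q; rewrite size_mul ?expf_neq0 ?polyXsubC_eq0 // size_exp_XsubC.
  by lia.
by exists b; rewrite mul_polyC.
Qed.

Lemma nuaut_pow1 : exists2 l : {poly R}, (size l <= 2)%N &
  img (ideal_pow 1) = l * T ^+ n.
Proof.
have [l lE] := idealE (phi (ideal_pow 1)); exists l => //.
have [->|l_neq0] := eqVneq l 0; first by rewrite size_poly0.
have := size_nuautE (ideal_pow 1).
rewrite lE ideal_powE size_mul ?expf_neq0 ?polyXsubC_eq0 // !size_exp_XsubC.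
by lia.
Qed.

End OneAutomorphism.

(** * Images of the powers of [T], which determine the automorphism *)

Lemma nuaut_pow0_unit (phi : nuaut I) : (0 < n)%N ->
  exists2 b, b \is a GRing.unit & phi (ideal_pow 0) = b *: ideal_pow 0.
Proof.
move=> n_gt0; have [b bE] := nuaut_pow0 phi n_gt0.
have [b' b'E] := nuaut_pow0 (nuaut_inv phi) n_gt0.
have {}bE : phi (ideal_pow 0) = b *: ideal_pow 0.
  by apply: ideal_val_inj; rewrite ideal_valZ ideal_powE.
have {}b'E : nuaut_inv phi (ideal_pow 0) = b' *: ideal_pow 0.
  by apply: ideal_val_inj; rewrite ideal_valZ ideal_powE.
exists b => //; apply/unitrPr; exists b'.
have := nuaut_invfunKV phi (ideal_pow 0).
rewrite [nuaut_invfun _ _]b'E nuautZ bE scalerA.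
move/(congr1 (fun p : I => lead_coef p)).
rewrite ideal_valZ lead_coefZ ideal_powE (monicP (monic_exp _ (monicXsubC a))).
by rewrite mulr1 mulrC.
Qed.

Lemma nuaut_pow (phi : nuaut I) : (0 < n)%N ->
  exists2 c, c \is a GRing.unit &
    forall k, phi (ideal_pow k) = c ^+ (k + n) *: ideal_pow k.
Proof.
move=> n_gt0; have [b b_unit bE] := nuaut_pow0_unit phi n_gt0.
have [l size_l lE] := nuaut_pow1 phi n_gt0.
pose s := b^-1 *: l.
have phi0 : ideal_val (phi (ideal_pow 0)) = b *: T ^+ n.
  by rewrite bE ideal_valZ ideal_powE.
have phi1 :
    ideal_val (phi (ideal_pow 1)) = s * ideal_val (phi (ideal_pow 0)).
  by rewrite phi0 lE -scalerAl -scalerAr scalerA mulVr // scale1r.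
have phi0_neq0 : ideal_val (phi (ideal_pow 0)) != 0.
  by rewrite ideal_val_eq0 nuaut_eq0 ideal_pow_neq0.
have phi_pow k :
    ideal_val (phi (ideal_pow k)) = s ^+ k * ideal_val (phi (ideal_pow 0)).
  elim: k => [|k IHk]; first by rewrite mul1r.
  (* The recursion is only visible after multiplying by the image of T^n, since products must be
     taken inside the ideal; that factor is then cancelled. *)
  by apply: (mulIf phi0_neq0); rewrite nuaut_pow_step IHk phi1 exprS; ring.
have s_n : s ^+ n = b *: T ^+ n.
  by apply: (mulIf phi0_neq0); rewrite -phi_pow nuaut_pow_sqr phi0 expr2.
(* Evaluating [s_n] at [a] gives s(a)^n = 0, because [n > 0]; a domain has no nilpotents. *)
have /factor_theorem[q sE] : root s a.
  have := congr1 (fun p => p.[a]) s_n.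
  rewrite hornerZ !horner_exp hornerXsubC subrr expr0n eqn0Ngt n_gt0 mulr0.
  by move/eqP; rewrite expf_eq0 n_gt0.
have [c {}sE] : exists c, s = c *: T.
  (* [s] has degree at most one and [T] already divides it, so the cofactor [q] is constant. *)
  exists q`_0; rewrite -mul_polyC -size1_polyC //.
  have [->|q_neq0] := eqVneq q 0; first by rewrite size_poly0.
  have : (size s <= 2)%N by apply: leq_trans (size_scale_leq _ _) size_l.
  by rewrite sE size_mul ?polyXsubC_eq0 // size_XsubC addn2.
have cb : c ^+ n = b.
  have := congr1 lead_coef s_n; rewrite sE exprZn !lead_coefZ.
  by rewrite (monicP (monic_exp _ (monicXsubC a))) !mulr1.
exists c; first by rewrite -(unitrX_pos _ n_gt0) cb.
move=> k; apply: ideal_val_inj; rewrite phi_pow ideal_valZ phi0.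
by rewrite ideal_powE sE exprZn -scalerAr -scalerAl scalerA -cb -!exprD addnC.
Qed.

Lemma nuaut_ext (phi psi : nuaut I) :
  (forall k, phi (ideal_pow k) = psi (ideal_pow k)) -> phi = psi.
Proof.
move=> eq_pow; apply: nuaut_eqP => p.
have [d] := ubnP (size p); elim: d p => // d IHd p lt_pd.
have [->|/ideal_lead_split[k [r [pE _ lt_r]]]] := eqVneq p 0.
  by rewrite !nuaut0.
by rewrite pE !nuautD !nuautZ eq_pow IHd // (leq_trans lt_r).
Qed.

(** * Dilations by units as automorphisms of the ideal *)

Definition ideal_dilation (c : R) (p : I) : I :=
  Ideal (dilation_pideal c (valP p)).

Lemma ideal_dilationK c : c \is a GRing.unit ->
  cancel (ideal_dilation c) (ideal_dilation c^-1).
Proof.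
by move=> c_unit p; apply: val_inj; rewrite /= dilation_comp mulVr // dilation1.
Qed.

Lemma dilation_is_nuaut (u : units R) :
  `[< is_nuaut (ideal_dilation (units_val u)) >].
Proof.
apply/asboolP; split=> [k p q|p q|].
- apply: ideal_val_inj; rewrite ideal_valD ideal_valZ -dilation_linear.
  by rewrite -ideal_valZ -ideal_valD.
- by apply: val_inj; apply: dilationM.
- exists (ideal_dilation (units_val u)^-1); first exact/ideal_dilationK/unitsP.
  rewrite -{2}[units_val u]invrK; apply: ideal_dilationK.
  by rewrite unitrV unitsP.
Qed.
Definition dilation_nuaut u : nuaut I := NuAut (dilation_is_nuaut u).

Lemma dilation_nuautM u v :
  dilation_nuaut (units_mul u v)
    = nuaut_mul (dilation_nuaut u) (dilation_nuaut v).
Proof.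
by apply: nuaut_eqP => p; apply: val_inj; rewrite /= dilation_comp.
Qed.

Lemma dilation_nuaut_pow u k :
  dilation_nuaut u (ideal_pow k) = (units_val u) ^+ (k + n) *: ideal_pow k.
Proof.
apply: ideal_val_inj; rewrite ideal_valZ ideal_powE -dilationXn.
by rewrite /= -exprD.
Qed.

(** Leading coefficients of the images of T^n and T^(n+1) recover u^n and u^(n+1); their quotient is
    u. *)
Lemma dilation_nuaut_inj : injective dilation_nuaut.
Proof.
move=> u v eq_uv; apply: val_inj => /=.
have eq_pow k : (units_val u) ^+ (k + n) = (units_val v) ^+ (k + n).
  have := congr1
    (fun phi : nuaut I => lead_coef (ideal_val (phi (ideal_pow k)))) eq_uv.
  rewrite !dilation_nuaut_pow !ideal_valZ !lead_coefZ ideal_powE.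
  by rewrite (monicP (monic_exp _ (monicXsubC a))) !mulr1.
apply: (@mulIr _ ((units_val u) ^+ n)); first by rewrite unitrX ?unitsP.
by rewrite -exprS -add1n eq_pow exprS (eq_pow 0%N).
Qed.

Lemma dilation_nuaut_surj (phi : nuaut I) : (0 < n)%N ->
  exists u, dilation_nuaut u = phi.
Proof.
move=> n_gt0; have [c c_unit cE] := nuaut_pow phi n_gt0.
by exists (Units c_unit); apply: nuaut_ext => k; rewrite dilation_nuaut_pow cE.
Qed.

End Automorphisms.

Theorem proposition2p13 (R : idomainType) (a : R) (n : nat)
    (n_gt0 : (1 <= n)%N) :
  exists phi : {multiplicative nuaut (ideal (('X - a%:P) ^+ n)) -> units R},
    bijective phi.
Proof.
(* The map sought is inverse to [dilation_nuaut]: surjectivity and choice give a section [g], and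
   injectivity makes it two-sided and multiplicative. *)
have /choice[g gK] := fun phi => @dilation_nuaut_surj R a n phi n_gt0.
have Kg : cancel (@dilation_nuaut R a n) g.
  by move=> u; apply: (@dilation_nuaut_inj R a n); rewrite gK.
have gM : {morph g : phi psi / nuaut_mul phi psi >-> units_mul phi psi}.
  move=> phi psi; apply: (@dilation_nuaut_inj R a n).
  by rewrite dilation_nuautM !gK.
pose g_mul := isMultiplicative.Build _ _ g gM.
pose G : {multiplicative nuaut (ideal (('X - a%:P) ^+ n)) -> units R} :=
  HB.pack g g_mul.
by exists G, (@dilation_nuaut R a n).
Qed.
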